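(* Let $(X,A)$ be a simplicial pair embedded in the Hilbert cube $Q$, and let $(X_i,A_i)_{i\leq n}$ be pairs of subcomplexes ($A_i\subseteq X_i$ subcomplexes of $X$) such that $X=\bigcup_{i\leq n}X_i$ and $A=\bigcup_{i\leq n}A_i$. If for every $i\leq n$ there is $\epsilon>0$ such that $(X_i,A_i)$ has the $\epsilon$-surjection property, then there exists $\delta>0$ such that $(X,A)$ has the $\delta$-surjection property.
   Context: Hilbert cube: $Q=[0,1]^{\mathbb{N}}$ with metric $d(x,y)=\sum_i 2^{-i}|x_i-y_i|$. For $Y\subseteq Q$ and $f,g:Y\to Q$, $d_Y(f,g)=\sup_{y\in Y}d(f(y),g(y))$. A pair $(Y,B)$ (compact $Y\subseteq Q$, compact $B\subseteq Y$) has the $\epsilon$-surjection property if every continuous $f:Y\to Y$ with $f|_B=\mathrm{id}_B$ and $d_Y(f,\mathrm{id}_Y)<\epsilon$ is surjective. A simplicial pair $(X,A)$ is a finite simplicial complex (a space homeomorphic to the standard realization $\{x\in[0,1]^{m+1}:\sum x_i=1,\{i:x_i\ne0\}\in S\}$ of an abstract finite simplicial complex $S$) together with a subcomplex $A$; by the paper's standing convention $A$ contains every free vertex of $X$ (a point with a neighborhood homeomorphic to $[0,1)$ via a homeomorphism sending it to $0$). *)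

(* Defs.v *)
From HB Require Import structures.
From mathcomp Require Import all_boot all_order all_algebra.
From mathcomp Require Import all_classical all_reals all_analysis.
Set Implicit Arguments.
Unset Strict Implicit.
Unset Printing Implicit Defensive.
Import Order.TTheory GRing.Theory Num.Theory.
Import numFieldNormedType.Exports.
Local Open Scope classical_set_scope.
Local Open Scope ring_scope.

(* Subspaces of the Hilbert cube are sets in the space of real sequences with
   the product topology, which on [hcube] is the topology of [hdist]. *)
Notation hspace R := (prod_topology (fun _ : nat => R)).

Definition hcube (R : realType) : set (hspace R) :=
  [set x | forall i : nat, 0 <= x i <= 1].
Arguments hcube R : clear implicits.

Definition hdist (R : realType) (x y : hspace R) : R :=
  limn (series (fun i : nat => 2 ^- i * `|x i - y i|)).

(* The supremum is taken in [R]; the set is bounded when [f] and [g] map [Y]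
   into [hcube R], and [sup set0 = 0] when [Y] is empty. *)
Definition hdist_on (R : realType) (Y : set (hspace R))
    (f g : hspace R -> hspace R) : R :=
  sup [set hdist (f y) (g y) | y in Y].

(* A map [Y -> Y] is represented by a function on the ambient space; only its
   values on [Y] matter. Intended for compact [Y] in [hcube R] and compact
   [B `<=` Y]. *)
Definition surjection_property (R : realType) (eps : R)
    (Y B : set (hspace R)) : Prop :=
  forall f : hspace R -> hspace R,
    set_fun Y Y f -> {within Y, continuous f} ->
    (forall x, B x -> f x = x) ->
    hdist_on Y f id < eps ->
    set_surj Y Y f.

Definition homeomorphism_on (T U : topologicalType) (A : set T) (B : set U)
    (h : T -> U) : Prop :=
  [/\ set_bij A B h, {within A, continuous h} &
      exists g : U -> T,
        (forall x, A x -> g (h x) = x) /\ {within B, continuous g}].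

(* Not every vertex of ['I_m.+1] is required to be a simplex, and the empty
   complex is allowed. *)
Definition simplicial_complex (m : nat) (S : {set {set 'I_m.+1}}) : Prop :=
  (forall F, F \in S -> F != finset.set0) /\
  (forall F G, F \in S -> G != finset.set0 -> G \subset F -> G \in S).

Definition realization (R : realType) (m : nat) (S : {set {set 'I_m.+1}}) :
    set 'rV[R]_m.+1 :=
  [set x | [/\ forall i, 0 <= x ord0 i <= 1,
               \sum_(i < m.+1) x ord0 i = 1 &
               [set i | x ord0 i != 0]%SET \in S]].
Arguments realization R {m} S.

(* [X] lies in the Hilbert cube and is identified with the realization of [S]
   by the homeomorphism [e]. *)
Definition embedded_complex (R : realType) (m : nat) (S : {set {set 'I_m.+1}})
    (e : 'rV[R]_m.+1 -> hspace R) (X : set (hspace R)) : Prop :=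
  [/\ simplicial_complex S, X `<=` hcube R &
      homeomorphism_on (realization R S) X e].

(* Subcomplexes refer to the triangulation of the ambient space given by [S]
   and [e]. *)
Definition subcomplex (R : realType) (m : nat) (S : {set {set 'I_m.+1}})
    (e : 'rV[R]_m.+1 -> hspace R) (Y : set (hspace R)) : Prop :=
  exists S' : {set {set 'I_m.+1}},
    [/\ simplicial_complex S', S' \subset S & Y = e @` realization R S'].

Definition free_vertex (R : realType) (X : set (hspace R)) (x : hspace R) :
    Prop :=
  X x /\
  exists U : set (hspace R),
    [/\ U `<=` X, U x, within X (nbhs x) U &
        exists h : hspace R -> R,
          homeomorphism_on U [set t : R | 0 <= t < 1] h /\ h x = 0].

Definition simplicial_pair (R : realType) (m : nat) (S : {set {set 'I_m.+1}})
    (e : 'rV[R]_m.+1 -> hspace R) (X A : set (hspace R)) : Prop :=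
  [/\ embedded_complex S e X, subcomplex S e A &
      forall x, free_vertex X x -> A x].

(* Main.v *)
(* Let [T] be a subcomplex of [S] and, for barycentric coordinates [y], let
   [t(y)] be the largest [min_(i in G) y_i] over the non-faces [G] of [T].
   Truncating the coordinates at [t(y)] and renormalising retracts a
   neighborhood of [|T|] in [|S|] onto [|T|] and shrinks carriers: only points
   of [|T|] itself can be sent into the interior of a facet of [S].
   If [f : X -> X] is close to the identity, fixes [A] and misses a point, then
   it misses an open set, hence an interior point [p] of some facet. This facet
   lies in some [X_i], and [f] followed by the retraction onto [X_i] is a
   self-map of [X_i] fixing [A_i] and close to the identity, so it takes the
   value [p]; as [p] is its own only preimage under the retraction, [f] takes
   it too. *)
Require Import Defs.
From mathcomp Require Import all_boot all_order all_algebra.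
From mathcomp Require Import all_classical all_reals all_analysis.
From mathcomp Require Import lra.
Import Order.TTheory GRing.Theory Num.Theory.
Import numFieldNormedType.Exports.
Local Open Scope classical_set_scope.
Local Open Scope ring_scope.

(** * The metric of the Hilbert cube and the product topology *)

Section HilbertCubeDistance.
Context {R : realType}.
Implicit Types x y z : hspace R.

Lemma hcube_dist_le1 x y i : hcube R x -> hcube R y -> `|x i - y i| <= 1.
Proof.
move=> /(_ i)/andP[x0 x1] /(_ i)/andP[y0 y1].
by rewrite ler_norml; apply/andP; split; lra.
Qed.

Lemma exprVn2_ge0 i : 0 <= 2 ^- i :> R.
Proof. by rewrite invr_ge0 exprn_ge0. Qed.

Lemma cvg_hseries : cvgn (series (fun i => 2 ^- i : R)).
Proof.
have -> : (fun i => 2 ^- i : R) = geometric 1 (2^-1).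
  by apply/funext => i; rewrite /geometric /= mul1r exprVn.
by apply: is_cvg_geometric_series; rewrite ger0_norm; lra.
Qed.

Lemma cvg_hdist x y : hcube R x -> hcube R y ->
  cvgn (series (fun i => 2 ^- i * `|x i - y i|)).
Proof.
move=> xQ yQ; apply: (series_le_cvg _ _ _ cvg_hseries) => i.
- by rewrite mulr_ge0 ?exprVn2_ge0.
- exact: exprVn2_ge0.
- by rewrite ler_piMr ?exprVn2_ge0 ?hcube_dist_le1.
Qed.

Lemma hdist_triangle x y z : hcube R x -> hcube R y -> hcube R z ->
  hdist x z <= hdist x y + hdist y z.
Proof.
move=> xQ yQ zQ.
rewrite /hdist -lim_seriesD; [|exact: cvg_hdist..].
apply: lim_series_le; first exact: cvg_hdist.
  by apply: is_cvg_seriesD; exact: cvg_hdist.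
move=> i; rewrite /= fctE -mulrDr ler_wpM2l ?exprVn2_ge0 //.
exact: ler_distD.
Qed.

Lemma hdistC x y : hdist x y = hdist y x.
Proof. by rewrite /hdist; under eq_fun do rewrite distrC. Qed.

Lemma hdist_ge_coord x y i : hcube R x -> hcube R y ->
  2 ^- i * `|x i - y i| <= hdist x y.
Proof.
move=> xQ yQ; pose u k : R := 2 ^- k * `|x k - y k|.
have u0 k : 0 <= u k by rewrite /u mulr_ge0 ?exprVn2_ge0.
apply: le_trans (nondecreasing_cvgn_le _ (cvg_hdist _ _ xQ yQ) i.+1).
  rewrite /series /= big_nat_recr //= lerDr.
  by apply: sumr_ge0 => k _; exact: u0.
by apply: nondecreasing_series => k _ _; exact: u0.
Qed.

(** The weights sum to [2], as the series starts at [i = 0]. So the first [N] terms contribute at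
    most [2 * a], and the tail, where coordinates differ by at most [1], at most [2 * 2 ^- N]. *)
Lemma hdist_le_prefix x y (N : nat) (a : R) : hcube R x -> hcube R y ->
  0 <= a -> (forall i, (i < N)%N -> `|x i - y i| <= a) ->
  hdist x y <= 2 * a + 2 * 2 ^- N.
Proof.
move=> xQ yQ a0 xya; apply: limr_le; first exact: cvg_hdist.
apply: nearW => k; rewrite /series /=.
have geo n : \sum_(0 <= i < n) 2 ^- i = 2 - 2 * 2 ^- n :> R.
  elim: n => [|n IH]; first by rewrite big_nil expr0 invr1; lra.
  by rewrite big_nat_recr //= IH exprS invfM; lra.
have geo_le n : \sum_(0 <= i < n) 2 ^- i <= 2 :> R.
  by rewrite geo lerBlDr lerDl mulr_ge0 ?exprVn2_ge0.
have tail n : (N <= n)%N -> \sum_(N <= i < n) 2 ^- i <= 2 * 2 ^- N :> R.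
  move=> Nn; have := geo n; rewrite (big_cat_nat (n := N)) //= geo => /eqP.
  have := exprVn2_ge0 n; move: (2 ^- n) (\sum_(N <= i < n) _) => u v.
  by move=> u0 /eqP; lra.
have [kN|/ltnW Nk] := leqP k N.
  apply: (@le_trans _ _ (\sum_(0 <= i < k) 2 ^- i * a)).
    apply: ler_sum_nat => i /andP[_ ik].
    by rewrite ler_wpM2l ?exprVn2_ge0 // xya // (leq_trans ik).
  rewrite -mulr_suml (le_trans (ler_wpM2r a0 (geo_le k))) //.
  by rewrite lerDl mulr_ge0 ?exprVn2_ge0.
rewrite (big_cat_nat (n := N)) //=; apply: lerD.
  apply: (@le_trans _ _ (\sum_(0 <= i < N) 2 ^- i * a)).
    apply: ler_sum_nat => i /andP[_ ik].
    by rewrite ler_wpM2l ?exprVn2_ge0 // xya.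
  by rewrite -mulr_suml ler_wpM2r.
apply: le_trans (tail _ Nk); apply: ler_sum_nat => i _.
by rewrite ler_piMr ?exprVn2_ge0 ?hcube_dist_le1.
Qed.

(** A product neighborhood controls finitely many coordinates and the weights bound the rest. With
    [hdist_lt_near], this shows that both topologies agree on the cube. *)
Lemma near_hdist_lt x (r : R) : hcube R x -> 0 < r ->
  \forall y \near x, hcube R y -> hdist x y < r.
Proof.
move=> xQ r0.
(* With prefix differences below [r / 8], the prefix bound is below [r / 4 + r / 2]. *)
have [N Nr] : exists N, 2 ^- N < r / 4 :> R.
  have /cvgr_dist_lt/(_ (r / 4))[|N _ /(_ N (leqnn N))] :
      (fun n => 2 ^- n : R) @ \oo --> (0 : R).
  - have -> : (fun i => 2 ^- i : R) = geometric 1 (2^-1).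
      by apply/funext => i; rewrite /geometric /= mul1r exprVn.
    by apply: cvg_geometric; rewrite ger0_norm; lra.
  - by lra.
  - by rewrite /= sub0r normrN ger0_norm ?exprVn2_ge0 // => ?; exists N.
have : nbhs x (fun y : hspace R => forall i : 'I_N, `|x i - y i| < r / 8).
  apply: (@filter_forall _ _ (fun (i : 'I_N) (y : hspace R) =>
    `|x i - y i| < r / 8) (nbhs x)) => i.
  have pc : (fun y : hspace R => y i) @ x --> x i.
    exact: (@proj_continuous nat (fun=> R) i x).
  have r8 : 0 < r / 8 by lra.
  by move/cvgrPdist_lt : pc => /(_ _ r8).
apply: filterS => y xy yQ.
have := @hdist_le_prefix x y N (r / 8) xQ yQ.
have /[swap]/[apply] : 0 <= r / 8 by lra.
have H i : (i < N)%N -> `|x i - y i| <= r / 8.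
  by move=> iN; have /ltW := xy (Ordinal iN).
by move=> /(_ H); lra.
Qed.

(** The [hdist] balls in the cube generate a filter that converges in each coordinate, hence in the
    product topology. *)
Lemma hdist_lt_near x (W : set (hspace R)) : hcube R x -> nbhs x W ->
  exists2 r : R, 0 < r & forall y, hcube R y -> hdist x y < r -> W y.
Proof.
move=> xQ.
pose F : set_system (hspace R) := filter_from [set r : R | 0 < r]
  (fun r => [set y | hcube R y /\ hdist x y < r]).
have FF : Filter F.
  apply: filter_from_filter; first by exists 1 => /=.
  move=> r s /= r0 s0; exists (Num.min r s); first by rewrite /= lt_min r0.
  by move=> y [yQ]; rewrite lt_min => /andP[].
have Fx : F --> x.
  apply/(@pointwise_cvgP nat R F x) => i; apply/cvgrPdist_lt => a a0.
  exists (2 ^- i * a) => /=; first by rewrite mulr_gt0 // invr_gt0 exprn_gt0.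
  move=> y [yQ xy]; have := le_lt_trans (hdist_ge_coord _ _ i xQ yQ) xy.
  by rewrite ltr_pM2l // invr_gt0 exprn_gt0.
by move=> /Fx[r r0 rW]; exists r => // y yQ xy; apply: rW.
Qed.

Lemma hdist_on_ub (Y : set (hspace R)) (f : hspace R -> hspace R) :
  Y `<=` hcube R -> set_fun Y Y f ->
  forall y, Y y -> hdist (f y) y <= hdist_on Y f id.
Proof.
move=> YQ fY y Yy; apply: ub_le_sup; last by exists y.
(* The prefix bound with an empty prefix bounds all distances in the cube, so [sup] is a genuine
   upper bound. *)
exists (2 * 1 + 2 * 2 ^- 0) => _ [z Yz <-].
apply: hdist_le_prefix => //; [exact/YQ/fY|exact: YQ].
Qed.

Lemma hdist_on_le (Y : set (hspace R)) (f : hspace R -> hspace R) (a : R) :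
  Y !=set0 -> (forall y, Y y -> hdist (f y) y <= a) ->
  hdist_on Y f id <= a.
Proof.
move=> [y Yy] H; apply: ge_sup; first by exists (hdist (f y) y), y.
by move=> _ [z Yz <-]; exact: H.
Qed.

End HilbertCubeDistance.

(** * Truncating barycentric coordinates onto a subcomplex *)

Section Collapse.
Context {R : realType} {m : nat}.
Implicit Types (T : {set {set 'I_m.+1}}) (y : 'rV[R]_m.+1).

Definition supp y : {set 'I_m.+1} := [set i | y ord0 i != 0]%SET.

(** For barycentric coordinates and a complex [T], this vanishes exactly on [|T|]. The defaults [0]
    and [1] are neutral for coordinates in [[0, 1]]. *)
Definition threshold T y : R :=
  \big[Num.max/0]_(G : {set 'I_m.+1} | (G != finset.set0) && (G \notin T))
    \big[Num.min/1]_(i in G) y ord0 i.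

(** The mass left after truncation. It is [1] on [|T|], hence nonzero nearby; [collapse] is
    meaningful only where it is nonzero. *)
Definition excess T y : R :=
  \sum_(i < m.+1) Num.max (y ord0 i - threshold T y) 0.

Definition collapse T y : 'rV[R]_m.+1 :=
  \row_i (Num.max (y ord0 i - threshold T y) 0 / excess T y).

Lemma threshold_ge0 T y : 0 <= threshold T y.
Proof. exact: bigmax_ge_id. Qed.

(** A non-face is not contained in the carrier of [y], which is a face, so it has a vertex where [y]
    vanishes. *)
Lemma threshold_eq0 T y : simplicial_complex T -> realization R T y ->
  threshold T y = 0.
Proof.
move=> [_ Tdown] [_ _ yT]; apply/eqP; rewrite eq_le threshold_ge0 andbT.
apply/bigmax_leP; split=> // G /andP[G0 GT].
have [i iG] : exists2 i, i \in G & i \notin supp y.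
  apply/subsetPn; apply: contra GT => GT; exact: Tdown GT.
rewrite inE negbK => /eqP yi0.
rewrite -yi0; exact: (bigmin_le_cond _ (fun j => y ord0 j)).
Qed.

(** Were this superlevel set a non-face, it would enter the maximum defining [threshold] with a
    minimum above [c]. *)
Lemma superlevel_mem T y c : (forall i, y ord0 i <= 1) ->
  threshold T y <= c -> (exists i, c < y ord0 i) ->
  [set i | c < y ord0 i]%SET \in T.
Proof.
move=> y1 tc [i cyi]; apply/negPn/negP => GT.
have : \big[Num.min/1]_(i in [set i | c < y ord0 i]%SET) y ord0 i <= c.
  apply: le_trans tc; apply: le_bigmax_cond; rewrite GT andbT.
  by apply/set0Pn; exists i; rewrite inE.
(* The default [1] of the minimum also exceeds [c], since some coordinate does and is at most
   [1]. *)
apply/negP; rewrite -ltNge; apply: lt_bigmin => [|j].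
  exact: lt_le_trans cyi (y1 i).
by rewrite inE.
Qed.

Lemma supp_superlevel y : (forall i, 0 <= y ord0 i <= 1) ->
  supp y = [set i | 0 < y ord0 i]%SET.
Proof.
move=> y01; apply/setP => i; rewrite !inE lt_def.
by case/andP: (y01 i) => ->; rewrite andbT.
Qed.

(** Replaces the combinatorial condition on carriers by a closed one, for use in the compactness
    proof; [superlevel_mem] at [c = 0] recovers the carrier. *)
Lemma realization_thresholdP T : simplicial_complex T ->
  realization R T = [set y : 'rV[R]_m.+1 | forall i, 0 <= y ord0 i] `&`
    [set y : 'rV[R]_m.+1 | forall i, y ord0 i <= 1] `&`
    [set y : 'rV[R]_m.+1 | \sum_(i < m.+1) y ord0 i = 1] `&`
    [set y : 'rV[R]_m.+1 | threshold T y <= 0].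
Proof.
move=> Tc; apply/seteqP; split => y.
  move=> yT; have t0 := threshold_eq0 _ _ Tc yT; case: yT => y01 y1 _.
  by split => /=; [split=> //; split=> i; case/andP: (y01 i)|rewrite t0].
move=> [[[/= yge0 yle1] y1] yt].
have y01 i : 0 <= y ord0 i <= 1 by rewrite yge0 yle1.
split=> //; rewrite -/(supp y) supp_superlevel //; apply: superlevel_mem => //.
apply: contrapT => /forallNP yN; move/eqP: y1; apply/negP.
rewrite big1 1?eq_sym ?oner_eq0 // => i _; apply/eqP.
by rewrite eq_le yge0 andbT leNgt; apply/negP/yN.
Qed.

Lemma threshold_continuous T : continuous (threshold T).
Proof.
apply: continuous_big => [|G _]; first exact: max_continuous.
apply: continuous_big => [|i _]; first exact: min_continuous.
exact: coord_continuous.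
Qed.

Lemma excess_term_continuous T i :
  continuous (fun y => Num.max (y ord0 i - threshold T y) 0).
Proof.
have sub_cont : continuous (fun y => y ord0 i - threshold T y).
  by move=> y; apply: (cvgB (@coord_continuous R _ _ ord0 i y)
    (threshold_continuous T y)).
apply: (@max_fun_continuous _ _ _ (fun y : 'rV[R]_m.+1 =>
  y ord0 i - threshold T y) (fun=> 0)) => //.
exact: cst_continuous.
Qed.

Lemma excess_continuous T : continuous (excess T).
Proof.
apply: continuous_big => [|i _]; last exact: excess_term_continuous.
exact: add_continuous.
Qed.

Lemma collapse_cvg T y : excess T y != 0 ->
  collapse T z @[z --> y] --> collapse T y.
Proof.
(* A neighborhood of a matrix contains a product of neighborhoods of its entries, so convergence is
   checked entrywise. *)
move=> y0 W [P Py PW]; have Fy : Filter (nbhs y) := nbhs_filter y.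
have : \forall z \near y, forall i j, P i j (collapse T z i j);
  last by apply: (@filterS _ _ Fy) => z Pz; exact: PW.
apply: (@filter_forall _ _ _ _ Fy) => i.
apply: (@filter_forall _ _ _ _ Fy) => j.
have : (collapse T z i j @[z --> y] --> collapse T y i j).
  under eq_cvg do rewrite mxE; rewrite mxE.
  apply: cvgM; first exact: excess_term_continuous.
  by apply: cvgV => //; exact: excess_continuous.
by apply; exact: Py.
Qed.

Lemma realization_compact T : simplicial_complex T ->
  compact (realization R T).
Proof.
move=> Tc; apply: bounded_closed_compact.
  exists 1; split=> // M M1 y [y01 _ _].
  rewrite /Num.norm /= mx_normrE; apply/bigmax_leP; split; first lra.
  move=> [i j] _ /=; rewrite ord1 ger0_norm; case/andP: (y01 j) => //.
  by move=> _ /le_trans; apply; exact: ltW.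
rewrite realization_thresholdP //.
apply: closedI; [apply: closedI; [apply: closedI|]|].
- have -> : [set y : 'rV[R]_m.+1 | forall i, 0 <= y ord0 i] =
      \bigcap_(i in [set: 'I_m.+1])
        ((fun y => y ord0 i) @^-1` [set x : R | 0 <= x]).
    by apply/seteqP; split=> y H i; [move=> _|]; exact: H.
  apply: closed_bigI => i _; apply: preimage_closed; last exact: closed_ge.
  by move=> y _; exact: coord_continuous.
- have -> : [set y : 'rV[R]_m.+1 | forall i, y ord0 i <= 1] =
      \bigcap_(i in [set: 'I_m.+1])
        ((fun y => y ord0 i) @^-1` [set x : R | x <= 1]).
    by apply/seteqP; split=> y H i; [move=> _|]; exact: H.
  apply: closed_bigI => i _; apply: preimage_closed; last exact: closed_le.
  by move=> y _; exact: coord_continuous.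
- apply: (@preimage_closed _ _ (fun y : 'rV[R]_m.+1 => \sum_(i < m.+1) y ord0 i)
    [set x | x = 1]); last exact: closed_eq.
  move=> y _; apply: continuous_big => [|i _]; first exact: add_continuous.
  exact: coord_continuous.
- apply: (@preimage_closed _ _ (threshold T) [set x | x <= 0]);
    last exact: closed_le.
  by move=> y _; exact: threshold_continuous.
Qed.

Lemma excess_realization T y : simplicial_complex T -> realization R T y ->
  excess T y = 1.
Proof.
move=> Tc yT; rewrite /excess threshold_eq0 //; case: yT => y01 <- _.
by apply: eq_bigr => i _; rewrite subr0 max_l //; case/andP: (y01 i).
Qed.

Lemma collapse_id T y : simplicial_complex T -> realization R T y ->
  collapse T y = y.
Proof.
move=> Tc yT; apply/rowP => i; rewrite mxE excess_realization // divr1.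
rewrite threshold_eq0 // subr0 max_l //.
by case: yT => /(_ i)/andP[].
Qed.

Lemma excess_ge0 T y : 0 <= excess T y.
Proof. by apply: sumr_ge0 => i _; rewrite le_max lexx orbT. Qed.

Lemma supp_collapse T y : excess T y != 0 ->
  supp (collapse T y) = [set i | threshold T y < y ord0 i]%SET.
Proof.
move=> e0; apply/setP => i; rewrite !inE mxE mulf_eq0 invr_eq0 (negbTE e0) orbF.
have [|] := leP (y ord0 i) (threshold T y) => yt.
  by rewrite max_r ?eqxx // subr_le0.
by rewrite max_l ?subr_ge0 ?(ltW yt) // subr_eq0 gt_eqF.
Qed.

(** The carrier of the image is the superlevel set of [y] at its threshold, nonempty since the
    excess is nonzero, hence a face of [T]. *)
Lemma collapse_realization S T y : realization R S y -> excess T y != 0 ->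
  realization R T (collapse T y).
Proof.
move=> [y01 y1 _] e0.
have egt0 : 0 < excess T y by rewrite lt_def e0 excess_ge0.
have c0 i : 0 <= collapse T y ord0 i.
  by rewrite mxE divr_ge0 ?excess_ge0 // le_max lexx orbT.
have c1 : \sum_(i < m.+1) collapse T y ord0 i = 1.
  under eq_bigr do rewrite mxE; rewrite -mulr_suml; exact: divff.
split=> //.
  move=> i; rewrite c0 /= -c1 (bigD1 i) //= lerDl.
  by apply: sumr_ge0.
rewrite -/(supp _) supp_collapse //; apply: superlevel_mem => //.
  by move=> i; case/andP: (y01 i).
apply: contrapT => /forallNP yN; move/eqP: e0; apply.
apply: big1 => i _; rewrite max_r // subr_le0 leNgt; exact/negP/yN.
Qed.

Lemma supp_collapse_sub S T y : realization R S y -> excess T y != 0 ->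
  supp (collapse T y) \subset supp y.
Proof.
move=> [y01 _ _] e0; rewrite supp_collapse // supp_superlevel //.
by apply/fintype.subsetP => i; rewrite !inE; exact/le_lt_trans/threshold_ge0.
Qed.

(* Contrapositively: a point outside [T] is sent into a proper face of its
   carrier, so it never hits the interior of a facet. *)
Lemma collapse_full_supp S T y : simplicial_complex T ->
  realization R S y -> excess T y != 0 ->
  supp y \subset supp (collapse T y) -> collapse T y = y.
Proof.
move=> Tc yS e0 sub; apply: collapse_id => //.
have [_ _ cT] := collapse_realization _ _ _ yS e0.
case: (yS) => y01 y1 _; split=> //; rewrite -/(supp y).
suff -> : supp y = supp (collapse T y) by [].
apply/eqP; rewrite finset.eqEsubset sub /=; exact: supp_collapse_sub yS e0.
Qed.

End Collapse.

(** * Limits within subsets, facet points and uniform estimates *)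

(** Allows a limit to be composed with a map that is continuous only within [B]. *)
Lemma cvg_to_within {T : Type} {U : topologicalType} (F : set_system T)
    (f : T -> U) (B : set U) (y : U) : Filter F ->
  f t @[t --> F] --> y -> (\forall t \near F, B (f t)) ->
  f t @[t --> F] `=>` within B (nbhs y).
Proof.
move=> FF fy fB W /fy; rewrite /fmap /= => fW.
by apply: filterS2 fB fW => t Bt; apply.
Qed.

Lemma realization_sub {R : realType} {m : nat} (T S : {set {set 'I_m.+1}}) :
  T \subset S -> realization R T `<=` realization R S.
Proof. by move=> /fintype.subsetP TS y [y01 y1 /TS]. Qed.

(* The missed point is pushed towards the barycenter of a facet containing its
   carrier; small pushes stay in the open set [~` C]. *)
Lemma facet_point {R : realType} {m : nat} (S : {set {set 'I_m.+1}})
    (e : 'rV[R]_m.+1 -> hspace R) (C : set (hspace R)) (k : 'rV[R]_m.+1) :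
  simplicial_complex S -> {within realization R S, continuous e} -> closed C ->
  realization R S k -> ~ C (e k) ->
  exists k', [/\ realization R S k', ~ C (e k') &
    forall G, G \in S -> supp k' \subset G -> G \subset supp k'].
Proof.
move=> Sc ec Ccl kS kC; have [k01 k1 suppS] := kS.
have Gmax : (supp k \in S) && (supp k \subset supp k) by rewrite suppS subxx.
(* A face of largest cardinality among those containing the carrier of [k] is a facet. *)
case: (@arg_maxnP _ (supp k) (fun G => (G \in S) && (supp k \subset G))
  (fun G => #|G|) Gmax) => G /andP[GS kG] maxG.
have G0 : (0 < #|G|)%N by rewrite card_gt0; exact: Sc.1.
pose b : 'rV[R]_m.+1 := \row_i (if i \in G then #|G|%:R^-1 else 0).
have b1 : \sum_(i < m.+1) b ord0 i = 1.
  under eq_bigr do rewrite mxE.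
  rewrite -big_mkcond /= sumr_const -[_ *+ _]mulr_natr mulVf //.
  by rewrite pnatr_eq0 -lt0n.
have b0 i : 0 <= b ord0 i by rewrite mxE; case: ifP => // _; rewrite invr_ge0.
(* For [0 < s < 1] the point [q s] has carrier exactly [G], and it tends to [k] as [s] tends to
   [0]. *)
pose q (s : R) := (1 - s) *: k + s *: b.
have qE s i : q s ord0 i = (1 - s) * k ord0 i + s * b ord0 i by rewrite !mxE.
have supp_q s : 0 < s -> s < 1 -> supp (q s) = G.
  move=> s0 s1; apply/setP => i; rewrite inE qE mxE.
  case: ifP => [iG|/negbT iG].
    apply: lt0r_neq0; apply: ltr_wpDl.
      by rewrite mulr_ge0 ?subr_ge0 ?(ltW s1) //; case/andP: (k01 i).
    by rewrite mulr_gt0 // invr_gt0 ltr0n.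
  have : i \notin supp k by apply: contra iG; apply/fintype.subsetP.
  by rewrite inE negbK => /eqP ->; rewrite !mulr0 addr0 eqxx.
have qS s : 0 < s -> s < 1 -> realization R S (q s).
  move=> s0 s1.
  have q0 i : 0 <= q s ord0 i.
    rewrite qE addr_ge0 // mulr_ge0 ?subr_ge0 ?(ltW s0) ?(ltW s1) //.
    by case/andP: (k01 i).
  have q1 : \sum_(i < m.+1) q s ord0 i = 1.
    under eq_bigr do rewrite qE.
    by rewrite big_split /= -!mulr_sumr k1 b1 !mulr1 subrK.
  split=> //; last by rewrite -/(supp (q s)) supp_q.
  move=> i; rewrite q0 /= -q1 (bigD1 i) //= lerDl.
  by apply: sumr_ge0.
have qk : q s @[s --> 0^'+] --> k.
  have qc : q s @[s --> (0 : R)] --> q 0.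
    apply: cvgD; apply: cvgZl => //; apply: cvgB => //; exact: cvg_cst.
  rewrite {2}/q subr0 scale1r scale0r addr0 in qc.
  exact: cvg_at_right_filter qc.
have qK : \forall s \near (0 : R)^'+, realization R S (q s).
  near=> s; apply: qS; near: s; [exact: nbhs_right_gt|exact: nbhs_right_lt].
have qC : \forall s \near (0 : R)^'+, ~ C (e (q s)).
  have Ck : nbhs (e k) (~` C).
    by apply: open_nbhs_nbhs; split=> //; exact: closed_openC.
  have eck := (subspace_continuousP _ _).1 ec _ kS.
  exact: (cvg_comp _ _ (cvg_to_within _ _ _ _ _ qk qK) eck _ Ck).
have [s [s0 s1 sC]] : exists s : R, [/\ 0 < s, s < 1 & ~ C (e (q s))].
  have /filter_ex[s [[s0 s1] sC]] : \forall s \near (0 : R)^'+,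
      (0 < s /\ s < 1) /\ ~ C (e (q s)).
    near=> s; split; [split|]; near: s => //;
      [exact: nbhs_right_gt|exact: nbhs_right_lt].
  by exists s.
exists (q s); split=> //; first exact: qS.
rewrite supp_q // => H HS GH.
have := maxG H; rewrite HS (fintype.subset_trans kG GH) => /(_ isT) HG.
suff -> : G = H by [].
by apply/eqP; rewrite finset.eqEcard GH.
Unshelve. all: by end_near.
Qed.

(** [rho] stands for a retraction that is meaningful only on [V]. Its limits at the points of [Y]
    give the estimate locally, and compactness of [Y] makes [d] uniform. *)
Lemma near_identity_uniform {R : realType} (X Y V : set (hspace R))
    (rho : hspace R -> hspace R) (eps : R) :
  X `<=` hcube R -> Y `<=` X -> compact Y -> 0 < eps ->
  (forall z, X z -> V z -> hcube R (rho z)) ->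
  (forall x, Y x -> \forall z \near within X (nbhs x), V z) ->
  (forall x, Y x -> rho z @[z --> within X (nbhs x)] --> x) ->
  \forall d \near (0 : R)^'+, forall y z, Y y -> X z -> hdist y z < d ->
    V z /\ hdist (rho z) y < eps.
Proof.
move=> XQ YX cY eps0 rhoQ nearV rhoc.
pose P d y := Y y -> forall z, X z -> hdist y z < d ->
    V z /\ hdist (rho z) y < eps.
suff : \forall d \near (0 : R)^'+, Y `<=` P d.
  by apply: filterS => d YP y z Yy; exact: YP.
move/compact_near_coveringP: cY; apply => x Yx.
have xQ : hcube R x by exact/XQ/YX.
have e2 : 0 < eps / 2 by lra.
have W : nbhs x (fun z => X z -> V z /\ hdist x (rho z) < eps / 2).
  have rx : nbhs x (fun z => X z ->
      hcube R (rho z) -> hdist x (rho z) < eps / 2).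
    exact: rhoc (near_hdist_lt _ _ xQ e2).
  have Vx : nbhs x (fun z => X z -> V z) by exact: nearV.
  apply: (filterS _ (filterI rx Vx)) => z [rz Vz] Xz.
  by split; [exact: Vz|apply: rz => //; exact: rhoQ (Vz Xz)].
have [r r0 rW] := hdist_lt_near _ _ xQ W.
have m0 : 0 < Num.min (r / 2) (eps / 2).
  by rewrite lt_min; apply/andP; split; lra.
(* If [y] is within [r / 2] of [x] and [d < r / 2], then [z] is within [r] of [x], and both [rho z]
   and [y] are within [eps / 2] of [x]. *)
exists ([set y | hcube R y -> hdist x y < Num.min (r / 2) (eps / 2)],
  [set d | d < r / 2]).
  split=> /=; [exact: near_hdist_lt|apply: nbhs_right_lt; lra].
move=> [y d] /= [] + dr Yy z Xz yz.
have yQ : hcube R y by exact/XQ/YX.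
have zQ : hcube R z by exact: XQ.
move=> /(_ yQ); rewrite lt_min => /andP[xyr xye].
have [|Vz xz] := rW z zQ _ Xz.
  by have := hdist_triangle _ _ _ xQ yQ zQ; lra.
split=> //; have := hdist_triangle _ _ _ (rhoQ z Xz Vz) xQ yQ.
by rewrite (hdistC (rho z) x); lra.
Qed.

(** * The retraction carried over to the embedded complex *)

Section SubcomplexRetraction.
Context {R : realType} {m : nat}.
Variables (S T : {set {set 'I_m.+1}}) (X : set (hspace R)).
Variables (e : 'rV[R]_m.+1 -> hspace R) (g : hspace R -> 'rV[R]_m.+1).
Hypotheses (Tc : simplicial_complex T) (TS : T \subset S).
Hypothesis (eS : set_fun (realization R S) X e).
Hypothesis (ec : {within realization R S, continuous e}).
Hypothesis (gX : set_fun X (realization R S) g).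
Hypothesis (ge : forall k, realization R S k -> g (e k) = k).
Hypothesis (gc : {within X, continuous g}).

Definition retract (z : hspace R) : hspace R := e (collapse T (g z)).

Let excess_at (x : hspace R) : X x ->
  excess T (g z) @[z --> within X (nbhs x)] --> excess T (g x).
Proof.
move=> Xx; have gx := (subspace_continuousP _ _).1 gc _ Xx.
exact: (cvg_comp _ _ gx (excess_continuous T (g x))).
Qed.

Lemma near_excess x : X x -> excess T (g x) != 0 ->
  \forall z \near within X (nbhs x), excess T (g z) != 0.
Proof.
move=> Xx ex0; have ne : nbhs (excess T (g x)) [set t | t != 0].
  by apply: open_nbhs_nbhs; split=> //; exact: open_neq.
exact: (excess_at _ Xx _ ne).
Qed.

(** Composes the limits of [g], [collapse] and [e]. As [e] is continuous only within [|S|], the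
    truncated points must be shown to lie there. *)
Lemma retract_cvg x : X x -> excess T (g x) != 0 ->
  retract z @[z --> within X (nbhs x)] --> retract x.
Proof.
move=> Xx ex0.
have gx := (subspace_continuousP _ _).1 gc _ Xx.
have cx := cvg_comp _ _ gx (collapse_cvg _ _ ex0).
have cS : \forall z \near within X (nbhs x),
    realization R S (collapse T (g z)).
  have Xn : within X (nbhs x) X by exact: withinT.
  apply: (filterS _ (filterI Xn (near_excess _ Xx ex0))) => z [Xz ez].
  exact/(realization_sub _ _ TS)/(collapse_realization _ _ _ (gX _ Xz) ez).
have eck := (subspace_continuousP _ _).1 ec _
  (realization_sub _ _ TS _ (collapse_realization _ _ _ (gX _ Xx) ex0)).
exact: (cvg_comp _ _ (cvg_to_within _ _ _ _ _ cx cS) eck).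
Qed.

Lemma excess_subcomplex x : (e @` realization R T) x -> excess T (g x) != 0.
Proof.
move=> [k kT <-]; rewrite ge; last exact: realization_sub kT.
by rewrite excess_realization ?oner_eq0.
Qed.

Lemma retract_id x : (e @` realization R T) x -> retract x = x.
Proof.
move=> [k kT <-]; rewrite /retract ge; last exact: realization_sub kT.
by rewrite collapse_id.
Qed.

Lemma retract_sub x : X x -> excess T (g x) != 0 ->
  (e @` realization R T) (retract x).
Proof.
move=> Xx ex0; exists (collapse T (g x)) => //.
exact: collapse_realization (gX _ Xx) ex0.
Qed.

Lemma subcomplex_sub : e @` realization R T `<=` X.
Proof. by move=> _ [k kT <-]; apply: eS; exact: realization_sub kT. Qed.

Lemma subcomplex_compact : compact (e @` realization R T).
Proof.
apply: continuous_compact; last exact: realization_compact.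
apply: continuous_subspaceW ec; exact: realization_sub.
Qed.

Lemma retract_near_identity (eps : R) : X `<=` hcube R -> 0 < eps ->
  \forall d \near (0 : R)^'+, forall y z, (e @` realization R T) y -> X z ->
    hdist y z < d -> excess T (g z) != 0 /\ hdist (retract z) y < eps.
Proof.
move=> XQ eps0.
apply: (@near_identity_uniform R X _ (fun z => excess T (g z) != 0)) => //.
- exact: subcomplex_sub.
- exact: subcomplex_compact.
- by move=> z Xz ez; apply/XQ/subcomplex_sub; exact: retract_sub.
- move=> x Tx; apply: near_excess; last exact: excess_subcomplex.
  exact: subcomplex_sub.
- move=> x Tx; rewrite -[X in _ --> X](retract_id _ Tx).
  apply: retract_cvg; last exact: excess_subcomplex.
  exact: subcomplex_sub.
Qed.

(** Applying [g] gives [collapse T (g x) = k]. Truncation shrinks carriers, so the carrier of [g x]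
    contains that of [k]; by maximality they are equal, and then truncation did not move [g x]. *)
Lemma retract_facet x k : X x -> excess T (g x) != 0 -> realization R S k ->
  (forall G, G \in S -> supp k \subset G -> G \subset supp k) ->
  retract x = e k -> g x = k.
Proof.
move=> Xx ex0 kS kfacet /(congr1 g).
have gS := gX _ Xx.
have cS := realization_sub _ _ TS _ (collapse_realization _ _ _ gS ex0).
rewrite !ge // => ck; rewrite -ck.
symmetry; apply: (collapse_full_supp S) => //; rewrite ck.
apply: kfacet; first by case: gS.
by rewrite -ck; exact: supp_collapse_sub gS ex0.
Qed.

End SubcomplexRetraction.

(** * Passing from the pieces to the whole complex *)

Theorem theorem21 (R : realType) (m : nat) (S : {set {set 'I_m.+1}})
    (e : 'rV[R]_m.+1 -> hspace R) (X A : set (hspace R))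
    (n : nat) (Xi Ai : 'I_n -> set (hspace R)) :
  simplicial_pair S e X A ->
  (forall i, subcomplex S e (Xi i)) ->
  (forall i, subcomplex S e (Ai i)) ->
  (forall i, Ai i `<=` Xi i) ->
  X = \bigcup_i Xi i ->
  A = \bigcup_i Ai i ->
  (forall i, exists2 eps : R, 0 < eps &
    surjection_property eps (Xi i) (Ai i)) ->
  exists2 delta : R, 0 < delta & surjection_property delta X A.
Proof.
move=> [[Sc XQ [[eS einj esurj] ec [g [ge gc]]]] _ _] subX _ AX XE AE surjX.
have gX : set_fun X (realization R S) g.
  by move=> _ /esurj[k kS <-]; rewrite ge.
have [T TP] := choice subX.
have /choice[eps epsP] i : exists r : R,
    0 < r /\ surjection_property r (Xi i) (Ai i).
  by have [r r0 rP] := surjX i; exists r.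
have XiX i : Xi i `<=` X by rewrite XE => x Xx; exists i.
(* Finitely many pieces admit a common [d]. The bound [eps i / 2] leaves room for the supremum,
   which preserves only weak inequalities. *)
have [d d0 dP] : exists2 d : R, 0 < d & forall i y z, Xi i y -> X z ->
    hdist y z < d -> excess (T i) (g z) != 0 /\
    hdist (retract (T i) e g z) y < eps i / 2.
  have dP : \forall d \near (0 : R)^'+, forall i y z, Xi i y -> X z ->
      hdist y z < d -> excess (T i) (g z) != 0 /\
      hdist (retract (T i) e g z) y < eps i / 2.
    apply: filter_forall => i; have [Tc TS ->] := TP i.
    apply: (@retract_near_identity _ _ S _ X) => //.
    by have [? _] := epsP i; lra.
  have [d [d0 dd]] := filter_ex (filterI (nbhs_right_gt (0 : R)) dP).
  by exists d.
exists d => // f fX fc fA fd; apply: contrapT => nsurj.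
have [x Xx nfx] : exists2 x, X x & ~ (f @` X) x.
  apply: contrapT => H; apply: nsurj => x Xx.
  by apply: contrapT => nfx; apply: H; exists x.
have Xcpt : compact X.
  have -> : X = e @` realization R S.
    apply/seteqP; split=> [z /esurj//|_ [k kS <-]]; exact: eS.
  exact: continuous_compact ec (realization_compact _ Sc).
(* A closed image leaves room to move the missed point into the interior of a facet. *)
have fXcl : closed (f @` X).
  apply: compact_closed; last exact: continuous_compact.
  by apply: hausdorff_product => _; exact: Rhausdorff.
have [k0 k0S k0x] := esurj _ Xx.
have [k [kS nfk kfacet]] : exists k, [/\ realization R S k,
    ~ (f @` X) (e k) &
    forall G, G \in S -> supp k \subset G -> G \subset supp k].
  by apply: (facet_point S e (f @` X) k0) => //; rewrite k0x.
have [i _ ki] : (\bigcup_i Xi i) (e k) by rewrite -XE; exact: eS.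
have [Tc TS XiE] := TP i; have [eps0 epsi] := epsP i.
have close y : Xi i y -> excess (T i) (g (f y)) != 0 /\
    hdist (retract (T i) e g (f y)) y < eps i / 2.
  move=> Xiy; have Xy := XiX _ _ Xiy; apply: dP => //; first exact: fX.
  rewrite hdistC; apply: le_lt_trans fd; exact: hdist_on_ub.
pose fi := retract (T i) e g \o f.
(* The bullets check that [fi] is a continuous self-map of the piece, fixes [Ai i] and is close to
   the identity; hence it takes the value [e k] at some [x']. *)
have [||||x' Xx' fx'] := epsi fi _ _ _ _ (e k) ki.
- move=> y Xiy; rewrite XiE; apply: (@retract_sub _ _ S _ X) => //.
    exact: fX (XiX i _ Xiy).
  exact: (close _ Xiy).1.
- apply/subspace_continuousP => y Xiy; have Xy := XiX _ _ Xiy.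
  have fy : f z @[z --> within (Xi i) (nbhs y)] --> f y.
    exact: (subspace_continuousP _ _).1 (continuous_subspaceW (XiX i) fc) _ Xiy.
  have fyX : \forall z \near within (Xi i) (nbhs y), X (f z).
    by near=> z; apply/fX/(XiX i); near: z; exact: withinT.
  have ry := @retract_cvg _ _ S (T i) X e g TS ec gX gc (f y) (fX _ Xy)
    (close _ Xiy).1.
  exact: (cvg_comp _ _ (cvg_to_within _ _ _ _ _ fy fyX) ry).
- move=> y Aiy; rewrite /fi /= fA; last by rewrite AE; exists i.
  apply: (@retract_id _ _ S) => //; rewrite -XiE; exact: AX.
- apply: (@le_lt_trans _ _ (eps i / 2)); last by lra.
  apply: hdist_on_le => [|y Xiy]; first by exists (e k).
  exact/ltW/(close _ Xiy).2.
have Xfx' : X (f x') by exact: fX (XiX i _ Xx').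
(* By [retract_facet], [g (f x') = k], so [f] takes the supposedly missed value [e k] at [x']. *)
apply: nfk; exists x'; first exact: (XiX i).
have /esurj[k' k'S k'x] := Xfx'; rewrite -k'x; congr e.
rewrite -(ge _ k'S) k'x.
apply: (@retract_facet _ _ S (T i) X e g) => //; exact: (close _ Xx').1.
Unshelve. all: by end_near.
Qed.
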